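(* Let $m \in \mathbb{S}$ and let $K$ be a $\mathbb{C}_m$-Hilbert space. Then $\mathcal{H} = K \times K$ can be given the structure of a right quaternionic Hilbert space, and there exists an anti self-adjoint and unitary operator $J \in \mathcal{B}(\mathcal{H})$ such that $$K = \mathcal{H}^{Jm}_{+},$$ where $K$ is identified with the subset $\{(x,0) : x \in K\}$ of $\mathcal{H}$ via $x \mapsto (x,0)$.
   Context: $\mathbb{H}$ is the division ring of quaternions, $\mathbb{S} = \{q \in \mathbb{H} : \overline{q} = -q,\ |q| = 1\}$ is the sphere of imaginary units, and for $m \in \mathbb{S}$, $\mathbb{C}_m = \{\alpha + m\beta : \alpha,\beta \in \mathbb{R}\}$, a real subalgebra of $\mathbb{H}$ isomorphic to $\mathbb{C}$ via $\alpha + m\beta \mapsto \alpha + i\beta$; a $\mathbb{C}_m$-Hilbert space is a complex Hilbert space with $\mathbb{C}_m$ as its field of scalars (scalars written on the right, inner product linear in the second variable). A right quaternionic Hilbert space is a right $\mathbb{H}$-module $\mathcal{H}$ with a map $\langle\cdot|\cdot\rangle : \mathcal{H}\times\mathcal{H}\to\mathbb{H}$ satisfying $\langle x|x\rangle \ge 0$ with equality iff $x=0$, $\langle x|y+zq\rangle = \langle x|y\rangle + \langle x|z\rangle q$, and $\langle x|y\rangle = \overline{\langle y|x\rangle}$, complete for the norm $\|x\| = \sqrt{\langle x|x\rangle}$. $\mathcal{B}(\mathcal{H})$ denotes the bounded right $\mathbb{H}$-linear operators on $\mathcal{H}$. $J \in \mathcal{B}(\mathcal{H})$ is anti self-adjoint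 and unitary if $J^* = -J$ and $J^2 = -I$. For such $J$, the slice Hilbert space is $\mathcal{H}^{Jm}_{+} = \{x \in \mathcal{H} : J(x) = x\cdot m\}$, which is a $\mathbb{C}_m$-Hilbert space with the operations and inner product inherited from $\mathcal{H}$. *)

(* Defs.v *)
From HB Require Import structures.
From mathcomp Require Import all_boot all_order all_algebra.
From mathcomp Require Import ring lra.
From mathcomp Require Import all_classical all_reals all_analysis.

Set Implicit Arguments.
Unset Strict Implicit.
Unset Printing Implicit Defensive.

Import Order.TTheory GRing.Theory Num.Theory.
Import numFieldNormedType.Exports.

Local Open Scope classical_set_scope.
Local Open Scope ring_scope.

(* [Quat a b c d] is a + b i + c j + d k. *)
Record quat (R : Type) := Quat { qre : R; qi : R; qj : R; qk : R }.

Section QuaternionRing.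
Variable R : realType.
Implicit Types p q r : quat R.

Definition quat_tuple q : R * R * R * R := (qre q, qi q, qj q, qk q).
Definition tuple_quat (t : R * R * R * R) : quat R :=
  Quat t.1.1.1 t.1.1.2 t.1.2 t.2.

Lemma quat_tupleK : cancel quat_tuple tuple_quat. Proof. by case. Qed.

HB.instance Definition _ := Choice.copy (quat R) (can_type quat_tupleK).

Definition qzero : quat R := Quat 0 0 0 0.
Definition qone : quat R := Quat 1 0 0 0.
Definition qopp q := Quat (- qre q) (- qi q) (- qj q) (- qk q).
Definition qadd p q :=
  Quat (qre p + qre q) (qi p + qi q) (qj p + qj q) (qk p + qk q).
Definition qmul p q := Quat
  (qre p * qre q - qi p * qi q - qj p * qj q - qk p * qk q)
  (qre p * qi q + qi p * qre q + qj p * qk q - qk p * qj q)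
  (qre p * qj q - qi p * qk q + qj p * qre q + qk p * qi q)
  (qre p * qk q + qi p * qj q - qj p * qi q + qk p * qre q).

Lemma qaddA : associative qadd.
Proof. by move=> p q r; rewrite /qadd /=; congr Quat; ring. Qed.
Lemma qaddC : commutative qadd.
Proof. by move=> p q; rewrite /qadd /=; congr Quat; ring. Qed.
Lemma qadd0 : left_id qzero qadd.
Proof. by case=> *; rewrite /qadd /=; congr Quat; ring. Qed.
Lemma qaddN : left_inverse qzero qopp qadd.
Proof. by case=> *; rewrite /qadd /=; congr Quat; ring. Qed.

HB.instance Definition _ := GRing.isZmodule.Build (quat R)
  qaddA qaddC qadd0 qaddN.

Lemma qmulA : associative qmul.
Proof. by move=> p q r; rewrite /qmul /=; congr Quat; ring. Qed.
Lemma qmul1l : left_id qone qmul.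
Proof. by case=> *; rewrite /qmul /=; congr Quat; ring. Qed.
Lemma qmul1r : right_id qone qmul.
Proof. by case=> *; rewrite /qmul /=; congr Quat; ring. Qed.
Lemma qmulDl : left_distributive qmul +%R.
Proof. by move=> p q r; congr Quat => /=; ring. Qed.
Lemma qmulDr : right_distributive qmul +%R.
Proof. by move=> p q r; congr Quat => /=; ring. Qed.
Lemma qone_neq0 : qone != 0 :> quat R.
Proof. by apply/eqP; case; apply/eqP; exact: oner_neq0. Qed.

HB.instance Definition _ := GRing.Zmodule_isNzRing.Build (quat R)
  qmulA qmul1l qmul1r qmulDl qmulDr qone_neq0.

Definition qreal (a : R) : quat R := Quat a 0 0 0.
Definition qconj q : quat R := Quat (qre q) (- qi q) (- qj q) (- qk q).
Definition qnormsq q : R := qre q ^+ 2 + qi q ^+ 2 + qj q ^+ 2 + qk q ^+ 2.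
Definition qnorm q : R := Num.sqrt (qnormsq q).

Definition qinv q : quat R := qconj q * qreal (qnormsq q)^-1.

Lemma qnormsq_eq0 q : (qnormsq q == 0) = (q == 0).
Proof.
apply/idP/idP => /eqP; last first.
  by move=> ->; rewrite /qnormsq /= expr0n /= !addr0.
case: q => a b c d; rewrite /qnormsq /= => e; apply/eqP.
have := (sqr_ge0 a, sqr_ge0 b, sqr_ge0 c, sqr_ge0 d) => -[[[ha hb] hc] hd].
have [ea eb ec ed] : [/\ a ^+ 2 = 0, b ^+ 2 = 0, c ^+ 2 = 0 & d ^+ 2 = 0].
  by split; lra.
have [-> -> -> -> //] : [/\ a = 0, b = 0, c = 0 & d = 0].
by split; apply/eqP; rewrite -sqrf_eq0; apply/eqP.
Qed.

Lemma qmulV : {in (fun q => q != 0), left_inverse 1 qinv *%R}.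
Proof.
move=> q q0; have {}q0 : qnormsq q != 0 by rewrite qnormsq_eq0.
rewrite /qinv; congr Quat => /=; move: q0; rewrite /qnormsq => q0; by field.
Qed.

Lemma qdivV : {in (fun q => q != 0), right_inverse 1 qinv *%R}.
Proof.
move=> q q0; have {}q0 : qnormsq q != 0 by rewrite qnormsq_eq0.
rewrite /qinv; congr Quat => /=; move: q0; rewrite /qnormsq => q0; by field.
Qed.

Lemma qunitP p q : q * p = 1 /\ p * q = 1 -> p != 0.
Proof.
move=> [qp1 _]; apply/eqP => p0; move: qp1; rewrite p0 mulr0 => /eqP.
by rewrite eq_sym oner_eq0.
Qed.

Lemma qinv_out : {in [predC (fun q => q != 0)], qinv =1 id}.
Proof.
move=> q; rewrite inE => /negPn/eqP ->.
by rewrite /qinv; congr Quat => /=; ring.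
Qed.

HB.instance Definition _ := GRing.NzRing_hasMulInverse.Build (quat R)
  qmulV qdivV qunitP qinv_out.

Lemma quat_unitE q : (q \is a GRing.unit) = (q != 0).
Proof. by []. Qed.

(* q >= 0 for a quaternion q: q is real and nonnegative. *)
Definition qge0 q : Prop := q = qreal (qre q) /\ 0 <= qre q.

End QuaternionRing.

Definition imagUnit (R : realType) : Type :=
  {q : quat R | (qconj q == - q) && (qnorm q == 1)}.

Definition imagUnit_val (R : realType) (m : imagUnit R) : quat R := sval m.
Coercion imagUnit_val : imagUnit >-> quat.

Section Slice.
Variables (R : realType) (m : imagUnit R).

Definition inCm : {pred quat R} :=
  fun q => `[< exists a b : R, q = qreal a + (m : quat R) * qreal b >].

Lemma inCmP (q : quat R) :
  reflect (exists a b : R, q = qreal a + (m : quat R) * qreal b) (q \in inCm).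
Proof. exact: asboolP. Qed.

Lemma imagUnitE : exists b c d : R, (m : quat R) = Quat 0 b c d.
Proof.
rewrite /imagUnit_val; case: m => -[a b c d] /= /andP[/eqP [a0] _].
by exists b, c, d; have -> : a = 0 by lra.
Qed.

Lemma inCm_divring : divring_closed inCm.
Proof.
have [b [c [d mE]]] := imagUnitE.
have mul_cl x y : x \in inCm -> y \in inCm -> x * y \in inCm.
  move=> /inCmP [a1 [b1 ->]] /inCmP [a2 [b2 ->]]; apply/inCmP.
  exists (a1 * a2 - b1 * b2 * (b ^+ 2 + c ^+ 2 + d ^+ 2)), (a1 * b2 + b1 * a2).
  by rewrite mE; congr Quat => /=; ring.
split=> [|x y /inCmP [a1 [b1 ->]] /inCmP [a2 [b2 ->]]|x y xS yS].
- by apply/inCmP; exists 1, 0; congr Quat => /=; ring.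
- by apply/inCmP; exists (a1 - a2), (b1 - b2); congr Quat => /=; ring.
apply: (mul_cl) => //; have [->|y0] := eqVneq y 0.
  by rewrite invr0; apply/inCmP; exists 0, 0; congr Quat => /=; ring.
have -> : y^-1 = qinv y by [].
rewrite /qinv; apply: mul_cl; last first.
  by apply/inCmP; exists (qnormsq y)^-1, 0; congr Quat => /=; ring.
move: yS => /inCmP [a2 [b2 ->]]; apply/inCmP; exists a2, (- b2).
by rewrite mE; congr Quat => /=; ring.
Qed.

HB.instance Definition _ := GRing.isDivringClosed.Build (quat R) inCm
  inCm_divring.

Definition Cm : Type := {q : quat R | q \in inCm}.

HB.instance Definition _ := SubChoice.on Cm.
HB.instance Definition _ := [SubChoice_isSubUnitRing of Cm by <:].

Lemma Cm_mulC : commutative (@GRing.mul Cm).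
Proof.
move=> x y; apply: val_inj; rewrite !rmorphM /=.
case: x y => x /= /inCmP [a1 [b1 ->]] [y /= /inCmP [a2 [b2 ->]]].
by have [b [c [d ->]]] := imagUnitE; congr Quat => /=; ring.
Qed.

HB.instance Definition _ := GRing.PzRing_hasCommutativeMul.Build Cm Cm_mulC.

Lemma Cm_field : GRing.field_axiom Cm.
Proof.
move=> x x0; rewrite unfold_in /=; rewrite quat_unitE.
by rewrite -(raddf0 (\val : Cm -> quat R)) (inj_eq val_inj).
Qed.

HB.instance Definition _ := GRing.ComUnitRing_isField.Build Cm Cm_field.

End Slice.

(* Right modules over A are left modules over the converse ring A^c. *)
Definition rscale (A : pzRingType) (V : lmodType A^c) (x : V) (a : A) : V :=
  (a : A^c) *: x.

Definition complete_for (R : realType) (V : zmodType) (nrm : V -> R) : Prop :=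
  forall u : nat -> V,
    (forall e : R, 0 < e -> exists N : nat,
       forall i j : nat, (N <= i)%N -> (N <= j)%N -> nrm (u i - u j) < e) ->
    exists l : V, nrm (u i - l) @[i --> \oo] --> (0 : R).

HB.mixin Record Lmodule_isRightQHilbert (R : realType) H
    of GRing.Lmodule (quat R)^c H := {
  qinner : H -> H -> quat R;
  qinner_ge0 : forall x, qge0 (qinner x x);
  qinner_eq0 : forall x, qinner x x = 0 <-> x = 0;
  qinner_linearr : forall x y z (q : quat R),
    qinner x (y + rscale z q) = qinner x y + qinner x z * q;
  qinner_conj : forall x y, qinner x y = qconj (qinner y x);
  qinner_complete : complete_for (fun x => Num.sqrt (qre (qinner x x)))
}.

#[short(type="rightQHilbertType")]
HB.structure Definition RightQHilbert (R : realType) :=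
  { H of GRing.Lmodule (quat R)^c H & Lmodule_isRightQHilbert R H }.

HB.mixin Record Lmodule_isCmHilbert (R : realType) (m : imagUnit R) K
    of GRing.Lmodule (Cm m)^c K := {
  cinner : K -> K -> Cm m;
  cinner_ge0 : forall x, qge0 (\val (cinner x x));
  cinner_eq0 : forall x, cinner x x = 0 <-> x = 0;
  cinner_linearr : forall x y z (a : Cm m),
    cinner x (y + rscale z a) = cinner x y + cinner x z * a;
  cinner_conj : forall x y, \val (cinner x y) = qconj (\val (cinner y x));
  cinner_complete : complete_for (fun x => Num.sqrt (qre (\val (cinner x x))))
}.

#[short(type="cmHilbertType")]
HB.structure Definition CmHilbert (R : realType) (m : imagUnit R) :=
  { K of GRing.Lmodule (Cm m)^c K & Lmodule_isCmHilbert R m K }.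

Section Operators.
Variables (R : realType) (H : rightQHilbertType R).

Definition hnorm (x : H) : R := Num.sqrt (qre (qinner x x)).

Definition bounded_op (T : H -> H) : Prop :=
  exists M : R, forall x : H, hnorm (T x) <= M * hnorm x.

(* S is the adjoint of T. *)
Definition is_adjoint (T S : H -> H) : Prop :=
  forall x y : H, qinner (T x) y = qinner x (S y).

Definition antiselfadjoint_unitary (J : H -> H) : Prop :=
  is_adjoint J (fun x => - J x) /\ (forall x : H, J (J x) = - x).

Definition slice_space (J : H -> H) (m : imagUnit R) : set H :=
  [set x | J x = rscale x (m : quat R)].

End Operators.

(* The data turning a bare type T into a right quaternionic Hilbert space, and
   the resulting space, whose carrier is T. *)
Definition rightQHilbert_on (R : realType) (T : Type) : Type :=
  RightQHilbert.axioms_ R T.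
Definition rightQHilbert_of (R : realType) (T : Type)
    (s : rightQHilbert_on R T) : rightQHilbertType R := RightQHilbert.Pack s.

(* The map f identifies the C_m-Hilbert space K with the subset S of H, the
   latter carrying the operations and inner product inherited from H. *)
Definition identifies_with (R : realType) (m : imagUnit R)
    (K : cmHilbertType m) (H : rightQHilbertType R) (f : K -> H) (S : set H) :
    Prop :=
  [/\ range f = S,
      {morph f : x y / x + y},
      forall (x : K) (a : Cm m), f (rscale x a) = rscale (f x) (\val a)
    & forall x y : K, qinner (f x) (f y) = \val (cinner x y)].

(* Main.v *)
Require Import Defs.
From HB Require Import structures.
From mathcomp Require Import all_boot all_order all_algebra.
From mathcomp Require Import ring lra.
From mathcomp Require Import all_classical all_reals all_analysis.

Set Implicit Arguments.
Unset Strict Implicit.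
Unset Printing Implicit Defensive.

Import Order.TTheory GRing.Theory Num.Theory.
Import numFieldNormedType.Exports.

Local Open Scope classical_set_scope.
Local Open Scope ring_scope.

(* Choose an imaginary unit n anticommuting with m. Then H = C_m + C_m n and
   n z = z^* n for z in C_m, so the quaternionic Hilbert space is K tensored
   with H over C_m, that is K + K n: the pair (x, y) stands for x + y n. The
   inner product of K extends by <x n | y> = - n <x | y> and
   <x | y n> = <x | y> n, and J is right multiplication by m on K, extended
   H-linearly: J (x + y n) = x m + (y m) n. As (y n) m = - (y m) n, the
   equation J X = X m forces y = 0. *)

(** * Conjugation and imaginary units *)

Section Quaternions.
Variable R : realType.
Implicit Types (p q : quat R) (a : R) (m : imagUnit R).

Lemma qconjD p q : qconj (p + q) = qconj p + qconj q.
Proof. by congr Quat => /=; ring. Qed.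

Lemma qconjN p : qconj (- p) = - qconj p.
Proof. by congr Quat. Qed.

Lemma qconjM p q : qconj (p * q) = qconj q * qconj p.
Proof. by congr Quat => /=; ring. Qed.

Lemma qconjK : involutive (@qconj R).
Proof. by case=> a b c d; rewrite /qconj /= !opprK. Qed.

Lemma qreal_comm a q : qreal a * q = q * qreal a.
Proof. by congr Quat => /=; ring. Qed.

Lemma qconj_qreal a : qconj (qreal a) = qreal a.
Proof. by rewrite /qconj /= oppr0. Qed.

Lemma qrealD a b : qreal (a + b) = qreal a + qreal b.
Proof. by congr Quat => /=; ring. Qed.

(** Lets the projection on C_m be handled through its double, free of the factor 1/2. *)
Lemma quat_double_inj p q : p + p = q + q -> p = q.
Proof. by case: p q => a b c d [a' b' c' d'] [] *; congr Quat; lra. Qed.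

Lemma imagUnit_conj m : qconj m = - (m : quat R).
Proof. by case: m => q /= /andP[/eqP]. Qed.

(** A purely imaginary quaternion squares to minus its squared norm. *)
Lemma imagUnit_mul m : (m : quat R) * m = - 1.
Proof.
case: m => q; rewrite /imagUnit_val /= => /andP[/eqP qE].
rewrite /qnorm -[1]sqrtr1 => /eqP/(congr1 (fun x => x ^+ 2)).
have ge0 : 0 <= qnormsq q by rewrite /qnormsq !addr_ge0// sqr_ge0.
rewrite !sqr_sqrtr// => qn.
case: q qE qn {ge0} => a b c d; rewrite /qnormsq /= => -[a0].
have -> : a = 0 by lra.
by move=> h; congr Quat => /=; lra.
Qed.

End Quaternions.

(** * A unit anticommuting with m *)

Definition orthUnit (R : realType) (m : imagUnit R) : Type :=
  {n : imagUnit R | (n : quat R) * m == - ((m : quat R) * n)}.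

Definition orthUnit_val (R : realType) (m : imagUnit R) (n : orthUnit m) :
  imagUnit R := sval n.
Coercion orthUnit_val : orthUnit >-> imagUnit.

(** Imaginary quaternions anticommute when they are orthogonal as vectors of R^3, so a unit vector
    orthogonal to m is enough. *)
Lemma orthUnit_inhabited (R : realType) (m : imagUnit R) :
  inhabited (orthUnit m).
Proof.
have [b [c [d mE]]] := imagUnitE m.
have wit (e f g : R) : e ^+ 2 + f ^+ 2 + g ^+ 2 = 1 ->
    b * e + c * f + d * g = 0 -> inhabited (orthUnit m).
  move=> h1 h2.
  pose q := Quat 0 e f g.
  have u : (qconj q == - q) && (qnorm q == 1).
    apply/andP; split; first by apply/eqP; congr Quat => /=; ring.
    by rewrite /qnorm /qnormsq /= expr0n /= add0r h1 sqrtr1.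
  pose n : imagUnit R := exist _ q u.
  have o : (n : quat R) * m == - ((m : quat R) * n).
    rewrite mE; apply/eqP; congr Quat => /=; try by ring.
    by lra.
  by exists; exact: (exist _ n o).
(* If m is a multiple of k, take n = i; otherwise turn (b, c) by a right angle and normalize. *)
have [bc0|bc0] := eqVneq (b ^+ 2 + c ^+ 2) 0.
  apply: (wit 1 0 0); first by ring.
  have : b ^+ 2 = 0 by have := sqr_ge0 b; have := sqr_ge0 c; lra.
  by move/eqP; rewrite sqrf_eq0 => /eqP ->; ring.
set s := b ^+ 2 + c ^+ 2 in bc0.
have s0 : 0 <= s by rewrite addr_ge0// sqr_ge0.
have r0 : Num.sqrt s != 0 by rewrite sqrtr_eq0 -ltNge lt_def bc0.
apply: (wit (- c / Num.sqrt s) (b / Num.sqrt s) 0); last by field.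
by rewrite !exprMn !exprVn sqr_sqrtr// /s; field.
Qed.

(** * The field C_m, its conjugation and the projection onto it *)

Section Cm.
Variables (R : realType) (m : imagUnit R).
Implicit Types (z w : Cm m) (q p : quat R).

Let mC := imagUnit_conj m.
Let mm := imagUnit_mul m.

Lemma Cm_valD z w : \val (z + w) = \val z + \val w. Proof. by []. Qed.
Lemma Cm_valN z : \val (- z) = - \val z. Proof. by []. Qed.
Lemma Cm_valM z w : \val (z * w) = \val z * \val w. Proof. by []. Qed.

Lemma Cm_conj_subproof z : qconj (\val z) \in inCm m.
Proof.
have /inCmP [a [b ->]] := valP z; apply/inCmP; exists a, (- b).
by rewrite qconjD qconjM !qconj_qreal qreal_comm mC; congr Quat => /=; ring.
Qed.

Definition cconj z : Cm m := Sub (qconj (\val z)) (Cm_conj_subproof z).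

Lemma val_cconj z : \val (cconj z) = qconj (\val z).
Proof. by rewrite SubK. Qed.

Lemma cconjK : involutive cconj.
Proof. by move=> z; apply: val_inj; rewrite !val_cconj qconjK. Qed.

Lemma cconjD z w : cconj (z + w) = cconj z + cconj w.
Proof. by apply: val_inj; rewrite val_cconj !Cm_valD !val_cconj qconjD. Qed.

Lemma cconjN z : cconj (- z) = - cconj z.
Proof. by apply: val_inj; rewrite val_cconj !Cm_valN val_cconj qconjN. Qed.

Lemma cconj0 : cconj 0 = 0.
Proof. by apply: (addrI (cconj 0)); rewrite -cconjD !addr0. Qed.

Lemma cconj1 : cconj 1 = 1.
Proof. by apply: val_inj; rewrite val_cconj; exact: qconj_qreal. Qed.

Lemma cconjM z w : cconj (z * w) = cconj z * cconj w.
Proof.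
by rewrite mulrC; apply: val_inj; rewrite val_cconj !Cm_valM !val_cconj qconjM.
Qed.

Lemma cm_unit_subproof : (m : quat R) \in inCm m.
Proof.
apply/inCmP; exists 0, 1.
by rewrite (erefl : qreal 0 = 0 :> quat R) (erefl : qreal 1 = 1 :> quat R)
  mulr1 add0r.
Qed.

Definition cm_unit : Cm m := Sub (m : quat R) cm_unit_subproof.

Lemma val_cm_unit : \val cm_unit = m :> quat R.
Proof. by rewrite SubK. Qed.

Lemma Cm_comm z : (m : quat R) * \val z = \val z * m.
Proof. by rewrite -val_cm_unit -!Cm_valM mulrC. Qed.

(** Moving n past a + m b flips the sign of m only, which is conjugation on C_m. *)
Lemma orthUnit_Cm (n : orthUnit m) z :
  (n : quat R) * \val z = qconj (\val z) * n.
Proof.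
have nm : (n : quat R) * m = - ((m : quat R) * n) by case: n => ? /= /eqP.
have /inCmP [a [b ->]] := valP z.
rewrite qconjD qconjM !qconj_qreal qreal_comm mC mulrDr mulrDl qreal_comm.
by rewrite mulrA nm !mulNr -!mulrA !qreal_comm.
Qed.

(* q - m q m is twice the orthogonal projection of q on C_m. *)
Lemma cpart_sig q :
  {z : Cm m | \val z + \val z = q - (m : quat R) * q * m}.
Proof.
(* The projection itself: the real part of q, plus m times the scalar product of the imaginary parts
   of q and m. *)
pose z := qreal (qre q) +
  (m : quat R) * qreal (qi q * qi m + qj q * qj m + qk q * qk m).
have zm : z \in inCm m by apply/inCmP; do 2 eexists.
exists (exist (fun p => p \in inCm m) z zm); rewrite /= /z {z zm}.
have : qi m ^+ 2 + qj m ^+ 2 + qk m ^+ 2 = 1.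
  have := congr1 (@qre R) mm; have := congr1 (@qre R) mC => /= h h'.
  by have := sqr_ge0 (qre m); nra.
have : qre m = 0 by have := congr1 (@qre R) mC => /=; lra.
case: q (m : quat R) => [x1 x2 x3 x4] [a b c d] /= -> h.
congr Quat => /=.
(* The explicit factor 1 is replaced through [h] by the squared norm of m, which leaves a polynomial
   identity. *)
- transitivity (x1 + x1 * 1); first by ring.
  by rewrite -h; ring.
- rewrite -[X in _ = X + _]mulr1 -h; ring.
- rewrite -[X in _ = X + _]mulr1 -h; ring.
- rewrite -[X in _ = X + _]mulr1 -h; ring.
Qed.

Definition cpart q : Cm m := sval (cpart_sig q).

Lemma cpartE q : \val (cpart q) + \val (cpart q) = q - (m : quat R) * q * m.
Proof. exact: svalP (cpart_sig q). Qed.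

End Cm.

(** * The decomposition H = C_m + C_m n *)

Section Decomposition.
Variables (R : realType) (m : imagUnit R) (n : orthUnit m).
Implicit Types (z w : Cm m) (q p : quat R).

(** If q = z + w n, then - q n = w - z n, whose C_m part is w. *)
Definition rpart q : Cm m := cpart m (- (q * n)).

Let mm := imagUnit_mul m.
Let nn := imagUnit_mul n.

Let nm : (n : quat R) * m = - ((m : quat R) * n).
Proof. by case: n => ? /= /eqP. Qed.

(** Twice the first term is q - m q m; twice the second is q + m q m, because n n = -1 and n m n =
    m. *)
Lemma quat_decomp q : q = \val (cpart m q) + \val (rpart q) * n.
Proof.
apply: quat_double_inj; rewrite addrACA -mulrDl !cpartE.
have nmn : (n : quat R) * ((m : quat R) * n) = m.
  by rewrite mulrA nm mulNr -mulrA nn mulrN1 opprK.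
rewrite mulrN mulNr opprK mulrDl mulNr -!mulrA nn mulrN1 opprK nmn.
by rewrite addrACA addNr addr0.
Qed.

Lemma quat_decomp_uniq z w q : q = \val z + \val w * n ->
  cpart m q = z /\ rpart q = w.
Proof.
(* The projection kills w' n, since m w' n m = w' n, and fixes z', since m z' m = - z'. *)
have key z' w' : cpart m (\val z' + \val w' * n) = z'.
  apply/val_inj/quat_double_inj; rewrite cpartE mulrDr mulrDl.
  rewrite [(m : quat R) * (_ * _)]mulrA !Cm_comm -!mulrA nm mm mulrN1.
  rewrite mulrN [(m : quat R) * (_ * _)]mulrA mm mulN1r opprK opprD opprK.
  by rewrite addrACA subrr addr0.
move=> ->; split; first exact: key.
rewrite /rpart -[RHS](key w (- z)); congr (cpart m _).
by rewrite mulrDl -mulrA nn mulrN1 opprD opprK addrC Cm_valN mulNr.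
Qed.

End Decomposition.

(** * Components of sums and products *)

Section PartAlgebra.
Variables (R : realType) (m : imagUnit R) (n : orthUnit m).
Implicit Types (q p : quat R) (z w : Cm m).

Let nn := imagUnit_mul n.

Lemma quat_partD p q :
  cpart m (p + q) = cpart m p + cpart m q /\
  rpart n (p + q) = rpart n p + rpart n q.
Proof.
apply: quat_decomp_uniq.
by rewrite !Cm_valD {1}(quat_decomp n p) {1}(quat_decomp n q) mulrDl addrACA.
Qed.

Lemma quat_part_Cm z : cpart m (\val z) = z /\ rpart n (\val z) = 0.
Proof. by apply: quat_decomp_uniq; rewrite mul0r addr0. Qed.

(** This is the Cayley-Dickson product on pairs over C_m; it comes from n z = z^* n and n n = -1. *)
Lemma quat_decompM z w z' w' :
  (\val z + \val w * n) * (\val z' + \val w' * n) =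
    \val (z * z' - w * cconj w') + \val (z * w' + w * cconj z') * n.
Proof.
have e (x y : Cm m) :
    \val x * (n : quat R) * \val y = \val x * qconj (\val y) * n.
  by rewrite -mulrA orthUnit_Cm mulrA.
rewrite !Cm_valD Cm_valN !Cm_valM !val_cconj.
rewrite mulrDl !mulrDr !mulrA !e -[_ * (n : quat R) * n]mulrA nn mulrN1 mulrDl.
by rewrite [X in _ + X = _]addrC addrACA.
Qed.

Lemma quat_partM p q :
  cpart m (p * q) = cpart m p * cpart m q - rpart n p * cconj (rpart n q) /\
  rpart n (p * q) = cpart m p * rpart n q + rpart n p * cconj (cpart m q).
Proof.
by apply: quat_decomp_uniq; rewrite -quat_decompM -!quat_decomp.
Qed.

End PartAlgebra.

(* The parameter n has no effect on the carrier: it selects the quaternionic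
   module structure. *)
Definition quat_extension (R : realType) (m : imagUnit R) (n : orthUnit m)
  (K : cmHilbertType m) : Type := (K * K)%type.

(** * Calculation rules in K *)

Section CmHilbertTheory.
Variables (R : realType) (m : imagUnit R) (K : cmHilbertType m).
Implicit Types (x y z : K) (a b : Cm m).

(** Here and below, laws of the left module over the converse ring are restated for right scalars,
    with products taken in C_m. *)
Lemma rscaleDl x a b : rscale x (a + b) = rscale x a + rscale x b.
Proof. exact: scalerDl. Qed.

Lemma rscaleDr x y a : rscale (x + y) a = rscale x a + rscale y a.
Proof. exact: scalerDr. Qed.

Lemma rscaleN x a : rscale x (- a) = - rscale x a.
Proof. exact: scaleNr. Qed.

Lemma rscaleNl x a : rscale (- x) a = - rscale x a.
Proof. exact: scalerN. Qed.

Lemma rscale0 x : rscale x (0 : Cm m) = 0.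
Proof. exact: scale0r. Qed.

Lemma rscale0l a : rscale (0 : K) a = 0.
Proof. exact: scaler0. Qed.

Lemma rscale1 x : rscale x (1 : Cm m) = x.
Proof. exact: scale1r. Qed.

Lemma rscaleA x a b : rscale (rscale x a) b = rscale x (a * b).
Proof. exact: scalerA. Qed.

Lemma cinnerD x y z : cinner x (y + z) = cinner x y + cinner x z.
Proof. by rewrite -[z in LHS]rscale1 cinner_linearr mulr1. Qed.

Lemma cinner0 x : cinner x 0 = 0.
Proof. by apply: (addrI (cinner x 0)); rewrite -cinnerD !addr0. Qed.

Lemma cinnerZ x y a : cinner x (rscale y a) = cinner x y * a.
Proof. by rewrite -[rscale y a]add0r cinner_linearr cinner0 add0r. Qed.

Lemma cinnerN x y : cinner x (- y) = - cinner x y.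
Proof. by apply: (addrI (cinner x y)); rewrite -cinnerD !subrr cinner0. Qed.

Lemma cinnerZl x y a : cinner (rscale x a) y = cconj a * cinner x y.
Proof.
apply: val_inj; rewrite cinner_conj cinnerZ !Cm_valM qconjM.
by rewrite -cinner_conj val_cconj.
Qed.

(** Passing to <x | x> moves the halving into the quaternions. *)
Lemma double_eq0 x : x + x = 0 -> x = 0.
Proof.
move=> xx; apply/cinner_eq0/val_inj/quat_double_inj.
by rewrite -Cm_valD -cinnerD xx cinner0 addr0.
Qed.

End CmHilbertTheory.

(** * The right quaternionic module of pairs *)

Section Extension.
Variables (R : realType) (m : imagUnit R) (n : orthUnit m).
Variable K : cmHilbertType m.
Let H := quat_extension n K.
Implicit Types (X Y Z : H) (p q : quat R).

HB.instance Definition _ := GRing.Zmodule.copy H (K * K)%type.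

(* With q = z + w n,
   (x + y n) q = (x z - y w^* ) + (x w + y z^* ) n. *)
Definition ext_scale (q : (quat R)^c) X : H :=
  (rscale X.1 (cpart m q) - rscale X.2 (cconj (rpart n q)),
   rscale X.1 (rpart n q) + rscale X.2 (cconj (cpart m q))).

Lemma ext_scaleA (p q : (quat R)^c) X :
  ext_scale p (ext_scale q X) = ext_scale (p * q) X.
Proof.
have [l r] := quat_partM n (q : quat R) p.
(* The product of the converse ring is the reversed quaternion product. *)
rewrite /ext_scale (_ : p * q = (q : quat R) * (p : quat R))// l r.
congr pair => /=.
- rewrite !rscaleDr !rscaleDl !rscaleNl !rscaleN !rscaleA.
  rewrite cconjD !cconjM cconjK rscaleDl !opprD addrACA.
  by congr (_ + _); exact: addrC.
- rewrite !rscaleDr !rscaleDl !rscaleNl !rscaleA.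
  rewrite cconjD cconjN !cconjM cconjK rscaleDl rscaleN addrACA.
  by congr (_ + _); exact: addrC.
Qed.

Lemma ext_scale1 : left_id 1 ext_scale.
Proof.
move=> [x y]; rewrite /ext_scale.
have [-> ->] : cpart m 1 = 1 /\ rpart n 1 = 0 := quat_part_Cm n 1.
by rewrite cconj0 cconj1 !rscale1 !rscale0 subr0 add0r.
Qed.

Lemma ext_scaleDr : right_distributive ext_scale +%R.
Proof.
move=> q X Y; rewrite /ext_scale !rscaleDr.
by congr pair; rewrite ?opprD addrACA.
Qed.

Lemma ext_scaleDl X : {morph ext_scale^~ X : p q / p + q}.
Proof.
move=> p q; have [l r] := quat_partD n p q.
rewrite /ext_scale l r !cconjD !rscaleDl.
by congr pair; rewrite ?opprD addrACA.
Qed.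

HB.instance Definition _ := GRing.Zmodule_isLmodule.Build (quat R)^c H
  ext_scaleA ext_scale1 ext_scaleDr ext_scaleDl.

(** * The quaternionic inner product *)

Let left_inner (x : K) Y : quat R :=
  \val (cinner x Y.1) + \val (cinner x Y.2) * (n : quat R).

Definition ext_inner X Y : quat R :=
  left_inner X.1 Y - (n : quat R) * left_inner X.2 Y.

Let nn := imagUnit_mul n.

(** The cross terms <x | y> n and - n <y | x> cancel by [orthUnit_Cm] and conjugate symmetry, while
    - n <y | y> n = <y | y>. *)
Lemma ext_inner_diag X :
  ext_inner X X = \val (cinner X.1 X.1 + cinner X.2 X.2).
Proof.
rewrite /ext_inner /left_inner mulrDr mulrA !orthUnit_Cm -mulrA nn -!cinner_conj.
by rewrite mulrN1 opprD opprK -addrA addNKr.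
Qed.

(** The coefficients of [ext_scale] are those of the product in [quat_decompM]. *)
Let left_inner_linear x Y Z q :
  left_inner x (Y + rscale Z q) = left_inner x Y + left_inner x Z * q.
Proof.
rewrite [in RHS](quat_decomp n q) quat_decompM /left_inner.
have -> : (Y + rscale Z q).1 =
  Y.1 + (rscale Z.1 (cpart m q) - rscale Z.2 (cconj (rpart n q))) by [].
have -> : (Y + rscale Z q).2 =
  Y.2 + (rscale Z.1 (rpart n q) + rscale Z.2 (cconj (cpart m q))) by [].
rewrite !cinnerD cinnerN !cinnerZ Cm_valD [\val (cinner x Y.2 + _)]Cm_valD.
by rewrite mulrDl addrACA.
Qed.

Lemma ext_inner_linearr X Y Z q :
  ext_inner X (Y + rscale Z q) = ext_inner X Y + ext_inner X Z * q.
Proof.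
rewrite /ext_inner !left_inner_linear mulrBl mulrDr mulrA opprD addrACA.
by [].
Qed.

Lemma ext_inner_conj X Y : ext_inner X Y = qconj (ext_inner Y X).
Proof.
rewrite /ext_inner /left_inner qconjD qconjN qconjM !qconjD !qconjM.
rewrite !imagUnit_conj -!cinner_conj mulrN opprK mulNr mulrDl mulNr.
by rewrite mulrDr opprD mulrA addrACA mulNr.
Qed.

Lemma ext_inner_ge0 X : qge0 (ext_inner X X).
Proof.
rewrite ext_inner_diag.
have [e1 h1] := cinner_ge0 X.1; have [e2 h2] := cinner_ge0 X.2.
by rewrite Cm_valD e1 e2 -qrealD; split => //=; exact: addr_ge0.
Qed.

Lemma ext_inner_eq0 X : ext_inner X X = 0 <-> X = 0.
Proof.
split=> [|->]; last by rewrite ext_inner_diag /= !cinner0 addr0.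
rewrite ext_inner_diag Cm_valD => e.
have [e1 h1] := cinner_ge0 X.1; have [e2 h2] := cinner_ge0 X.2.
have := congr1 (@qre R) e => /= e'.
have /cinner_eq0 X1 : cinner X.1 X.1 = 0.
  by apply: val_inj; rewrite e1 (_ : qre _ = 0)//; lra.
have /cinner_eq0 X2 : cinner X.2 X.2 = 0.
  by apply: val_inj; rewrite e2 (_ : qre _ = 0)//; lra.
by case: X X1 X2 {e e1 e2 h1 h2 e'} => x y /= -> ->.
Qed.

(** * Completeness *)

Let cnorm (x : K) : R := Num.sqrt (qre (\val (cinner x x))).

Let ext_norm X : Num.sqrt (qre (ext_inner X X)) =
  Num.sqrt (cnorm X.1 ^+ 2 + cnorm X.2 ^+ 2).
Proof.
have [_ h1] := cinner_ge0 X.1; have [_ h2] := cinner_ge0 X.2.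
by rewrite ext_inner_diag /cnorm !sqr_sqrtr.
Qed.

Lemma ext_complete : complete_for (fun X : H => Num.sqrt (qre (ext_inner X X))).
Proof.
move=> u cau.
have cn0 (x : K) : 0 <= cnorm x := sqrtr_ge0 _.
(* The norm of a pair dominates that of each component, so both component sequences are Cauchy in
   K. *)
have le1 X : cnorm X.1 <= Num.sqrt (qre (ext_inner X X)).
  by rewrite ext_norm -[leLHS]ger0_norm// -sqrtr_sqr ler_wsqrtr// lerDl sqr_ge0.
have le2 X : cnorm X.2 <= Num.sqrt (qre (ext_inner X X)).
  by rewrite ext_norm -[leLHS]ger0_norm// -sqrtr_sqr ler_wsqrtr// lerDr sqr_ge0.
have [x xl] : exists l : K, cnorm ((u i).1 - l) @[i --> \oo] --> (0 : R).
  apply: cinner_complete => e e0; have [N NP] := cau e e0.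
  exists N => i j Ni Nj; apply: le_lt_trans (NP i j Ni Nj).
  exact: (le1 (u i - u j)).
have [y yl] : exists l : K, cnorm ((u i).2 - l) @[i --> \oo] --> (0 : R).
  apply: cinner_complete => e e0; have [N NP] := cau e e0.
  exists N => i j Ni Nj; apply: le_lt_trans (NP i j Ni Nj).
  exact: (le2 (u i - u j)).
exists (x, y); under eq_fun do rewrite ext_norm.
(* The limit 0 is spelled in the shape that [cvgD] and [cvgM] produce. *)
have h : (cnorm ((u i).1 - x) ^+ 2 + cnorm ((u i).2 - y) ^+ 2) @[i --> \oo] -->
    (0 * 0 + 0 * 0 : R).
  by apply: cvgD; under eq_fun do rewrite expr2; exact: cvgM.
have := cvg_comp _ _ h (@sqrt_continuous R _).
by rewrite mulr0 addr0 sqrtr0.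
Qed.

HB.instance Definition _ := Lmodule_isRightQHilbert.Build R H
  ext_inner_ge0 ext_inner_eq0 ext_inner_linearr ext_inner_conj ext_complete.

(** * The operator J *)

Definition ext_J X : H := (rscale X.1 (cm_unit m), rscale X.2 (cm_unit m)).

(** C_m is commutative, so multiplying both components by m commutes with the C_m coefficients of
    [ext_scale]. *)
Lemma ext_J_linear : linear ext_J.
Proof.
move=> q X Y; have e (Z : H) : q *: Z = ext_scale q Z by [].
rewrite !e /ext_J /ext_scale; congr pair => /=.
- by rewrite !rscaleDr !rscaleNl !rscaleA ![cm_unit m * _]mulrC.
- by rewrite !rscaleDr !rscaleA ![cm_unit m * _]mulrC.
Qed.

HB.instance Definition _ := GRing.isLinear.Build (quat R)^c H H *:%R ext_J
  ext_J_linear.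


Let cm_unit_sqr (x : K) : rscale (rscale x (cm_unit m)) (cm_unit m) = - x.
Proof.
rewrite rscaleA (_ : _ * _ = -1) ?rscaleN ?rscale1//.
by apply: val_inj; rewrite Cm_valM val_cm_unit imagUnit_mul.
Qed.

Lemma ext_J_sqr X : ext_J (ext_J X) = - X.
Proof.
by case: X => x y; rewrite /ext_J /= !cm_unit_sqr.
Qed.

Let cinner_unit (x y : K) :
  cinner (rscale x (cm_unit m)) y = - cinner x (rscale y (cm_unit m)).
Proof.
rewrite cinnerZl cinnerZ mulrC -mulrN; congr (_ * _); apply: val_inj.
by rewrite val_cconj Cm_valN val_cm_unit imagUnit_conj.
Qed.

Lemma ext_J_adjoint : is_adjoint (ext_J : H -> H) (fun X => - ext_J X).
Proof.
move=> X Y; rewrite /qinner /= /ext_inner /left_inner.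
have -> : (- ext_J Y).1 = - rscale Y.1 (cm_unit m) by [].
have -> : (- ext_J Y).2 = - rscale Y.2 (cm_unit m) by [].
by rewrite /ext_J /= !cinner_unit !cinnerN.
Qed.

(** <J X | J X> = <X | - J J X>; this gives boundedness with constant 1. *)
Lemma ext_inner_J X : qinner (ext_J X) (ext_J X) = qinner X X.
Proof. by rewrite ext_J_adjoint ext_J_sqr opprK. Qed.

(** * K as the slice space of J *)

Definition ext_embed (x : K) : H := (x, 0).

Lemma ext_slice : range ext_embed = slice_space (ext_J : H -> H) m.
Proof.
have [l r] := quat_part_Cm n (cm_unit m); rewrite val_cm_unit in l r.
have scE (X : H) : rscale X (m : quat R) =
    (rscale X.1 (cm_unit m), rscale X.2 (cconj (cm_unit m))).
  transitivity (ext_scale m X); first by [].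
  by rewrite /ext_scale l r cconj0 !rscale0 subr0 add0r.
apply/seteqP; split=> [_ [x _ <-]|[x y]]; rewrite /slice_space /=.
  by rewrite scE /ext_J /= !rscale0l.
rewrite scE => -[] /= e; exists x => //; rewrite /ext_embed.
(* The second components of J X = X m give y m = y m^* = - y m. *)
have {}e : rscale y (cm_unit m) = 0.
  apply/double_eq0; rewrite {1}e -rscaleDl.
  rewrite (_ : _ + _ = 0) ?rscale0//; apply: val_inj.
  by rewrite Cm_valD val_cconj val_cm_unit imagUnit_conj addNr.
(* Now y = - (y m) m = 0. *)
by rewrite -[y]opprK -(cm_unit_sqr y) e rscale0l oppr0.
Qed.

Lemma ext_rscale_embed (x : K) (a : Cm m) :
  ext_embed (rscale x a) = rscale (ext_embed x) (\val a).
Proof.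
have [l r] := quat_part_Cm n a.
transitivity (ext_scale (\val a) (ext_embed x)); last by [].
by rewrite /ext_scale l r /= !rscale0l rscale0 subr0 addr0.
Qed.

Lemma ext_inner_embed (x y : K) :
  qinner (ext_embed x) (ext_embed y) = \val (cinner x y).
Proof.
transitivity (ext_inner (ext_embed x) (ext_embed y)); first by [].
have c0 (z : K) : cinner 0 z = 0.
  by apply: val_inj; rewrite cinner_conj cinner0; exact: qconj_qreal.
by rewrite /ext_inner /left_inner /= cinner0 !c0 mul0r !addr0 mulr0 subr0.
Qed.

End Extension.

Theorem proposition2p8 (R : realType) (m : imagUnit R) (K : cmHilbertType m) :
  exists s : rightQHilbert_on R (K * K)%type,
    let H : rightQHilbertType R := rightQHilbert_of s in
    (forall u v : (K * K)%type, (u : H) + (v : H) = (u.1 + v.1, u.2 + v.2)) /\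
    exists J : {linear H -> H},
      [/\ bounded_op J, antiselfadjoint_unitary J
        & identifies_with (fun x : K => (x, 0) : H) (slice_space J m)].
Proof.
have [n] := orthUnit_inhabited m.
pose H : rightQHilbertType R := quat_extension n K.
(* [quat_extension n K] unfolds to K * K, so its structure is one on the bare product, with
   componentwise addition by conversion. *)
exists (RightQHilbert.class H); split; first by [].
exists (@ext_J R m n K : {linear H -> H}); split.
- by exists 1 => X; rewrite mul1r /hnorm ext_inner_J.
- by split; [exact: ext_J_adjoint | exact: ext_J_sqr].
split.
- exact: ext_slice.
- by move=> x y; rewrite -[RHS]/(x + y, 0 + 0) addr0.
- exact: ext_rscale_embed.
- exact: ext_inner_embed.
Qed.
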